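(* For $n\ge1$ and $k\ge2$, let $$ H_{n,k}(\varphi)=\frac{(-1)^k}{k!}\sum_{l=2}^k(-1)^l\binom{k}{l}\,\bar\varphi^{\,k-l}\,\frac{\partial^nS_l[\varphi]}{\partial\mu^n}\Big|_{\mu=0}. $$ Then $$H_{n,k}(\varphi)=0\qquad\text{for all }k>2n.$$
   Context: $g(x,y)$ is the covariance (hence symmetric) of a centered (regularized) Gaussian process on $\mathbb{R}^d$, $\mathcal D\subset\mathbb{R}^d$ is a compact region, $\varphi>0$ is a fixed function on $\mathcal D$, and $\bar\varphi=\int_{\mathcal D}\varphi(x)\,dx$. The quantities $$S_l[\varphi](\mu)=\int_{\mathcal D^l}\prod_{i=1}^l\varphi(x_i)\,\exp\Bigl(\mu\sum_{1\le i<j\le l}g(x_i,x_j)\Bigr)dx_1\cdots dx_l$$ are the positive integer moments of the total mass $\int_{\mathcal D}\varphi(x)M_\mu(dx)$ of the associated random measure; they are treated formally, i.e. as formal power series in $\mu$, obtained by expanding the exponential under the integral sign. *)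

(* Defs.v *)
From HB Require Import structures.
From mathcomp Require Import all_boot all_order all_algebra.
From mathcomp Require Import all_classical all_reals all_analysis.

Set Implicit Arguments.
Unset Strict Implicit.
Unset Printing Implicit Defensive.
Import Order.TTheory GRing.Theory Num.Theory.
Import numFieldNormedType.Exports.
Local Open Scope classical_set_scope.
Local Open Scope ring_scope.

Definition tuple_cons d (T : measurableType d) (n : nat)
  (p : T * n.-tuple T) : n.+1.-tuple T := [tuple of p.1 :: p.2].

Lemma measurable_tuple_cons d (T : measurableType d) (n : nat) :
  measurable_fun [set: T * n.-tuple T] (@tuple_cons d T n).
Proof. by apply: measurable_cons. Qed.

Section cons_measure.
Context d (T : measurableType d) (R : realType) (n : nat).
Variables (m : {sigma_finite_measure set T -> \bar R})
  (mn : {sigma_finite_measure set (n.-tuple T) -> \bar R}).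

Definition cons_measure : set (n.+1.-tuple T) -> \bar R :=
  pushforward (m \x mn)%E (@tuple_cons d T n).

Let cons_measure0 : (cons_measure set0 = 0)%E.
Proof. by rewrite /cons_measure /pushforward preimage_set0 measure0. Qed.

Let cons_measure_ge0 A : (0 <= cons_measure A)%E.
Proof. by rewrite /cons_measure /pushforward measure_ge0. Qed.

Let cons_measure_sigma_additive : semi_sigma_additive cons_measure.
Proof.
move=> F mF tF mUF; rewrite /cons_measure /pushforward preimage_bigcup.
apply: measure_semi_sigma_additive.
- by move=> k; rewrite -[X in measurable X]setTI; exact: measurable_tuple_cons.
- apply/trivIsetP => /= i j _ _ ij; rewrite -preimage_setI.
  by move/trivIsetP : tF => ->//; rewrite preimage_set0.
- rewrite -preimage_bigcup -[X in measurable X]setTI.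
  exact: measurable_tuple_cons.
Qed.

HB.instance Definition _ := isMeasure.Build _ _ _ cons_measure
  cons_measure0 cons_measure_ge0 cons_measure_sigma_additive.

Lemma cons_measure_sigma_finite : sigma_finite setT cons_measure.
Proof.
have /sigma_finiteP[F [UF ndF Ffin]] := sigma_finiteT m.
have /sigma_finiteP[G [UG ndG Gfin]] := sigma_finiteT mn.
pose split_tuple (t : n.+1.-tuple T) : T * n.-tuple T :=
  (thead t, [tuple of behead t]).
have mS : measurable_fun setT split_tuple.
  apply/measurable_fun_pair => //; first exact: measurable_tnth.
  exact: measurable_behead.
have splitK : cancel (@tuple_cons d T n) split_tuple.
  move=> [x t]; by congr pair; exact/val_inj.
exists (fun i => split_tuple @^-1` (F i `*` G i)).
  apply/esym; rewrite -subTset => t _.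
  have : setT (thead t) by []. rewrite UF => -[i _ Fi].
  have : setT [tuple of behead t] by []. rewrite UG => -[j _ Gj].
  exists (maxn i j) => //; split => /=.
    by apply: subsetPset Fi; apply: ndF; exact: leq_maxl.
  by apply: subsetPset Gj; apply: ndG; exact: leq_maxr.
move=> i; have [mF finF] := Ffin i; have [mG finG] := Gfin i.
have mFG : measurable (F i `*` G i) by exact: measurableX.
split; first by rewrite -[X in measurable X]setTI; exact: mS.
rewrite /cons_measure /pushforward -comp_preimage.
have -> : split_tuple \o @tuple_cons d T n = id.
  by apply/funext => p /=; rewrite splitK.
by rewrite preimage_id product_measure1E// lte_mul_pinfty// ge0_fin_numE.
Qed.

HB.instance Definition _ :=
  Measure_isSigmaFinite.Build _ _ _ cons_measure
    cons_measure_sigma_finite.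

End cons_measure.

(* The n-fold product measure, on n-tuples; the library only has binary
   products. *)
Fixpoint power_measure d (T : measurableType d) (R : realType)
    (m : {sigma_finite_measure set T -> \bar R}) (n : nat) :
    {sigma_finite_measure set (n.-tuple T) -> \bar R} :=
  match n return {sigma_finite_measure set (n.-tuple T) -> \bar R} with
  | 0 => dirac (nil_tuple T)
  | n'.+1 => cons_measure m (power_measure m n')
  end.

(* The d-dimensional Euclidean space as a measurable space. *)
Definition euclid (R : realType) (d : nat) := d.-tuple (measurableTypeR R).

Definition lebesgue (R : realType) (d : nat) :=
  power_measure (@lebesgue_measure R) d.

(* Tuples carry no topology in the library, row vectors do. *)
Definition euclid_compact (R : realType) (d : nat) (D : set (euclid R d)) :=
  compact [set (\row_(i < d) tnth x i : 'rV[R]_d) | x in D].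

Definition set_power (T : Type) (l : nat) (D : set T) : set (l.-tuple T) :=
  [set x | forall i, D (tnth x i)].
Arguments set_power {T} l D.

(* Degenerate (constant) variables are Gaussian; normal_prob m 0 is not the
   Dirac mass at m, hence the case distinction. *)
Definition gaussian d (Omega : measurableType d) (R : realType)
    (P : probability Omega R) (Y : Omega -> R) :=
  exists m s : R, forall A : set (measurableTypeR R), measurable A ->
    P (Y @^-1` A) = (if s == 0 then \d_m A else normal_prob m s A).

Definition centered_gaussian_process d (Omega : measurableType d)
    (R : realType) (P : probability Omega R) (I : Type)
    (X : I -> {RV P >-> R}) :=
  (forall t, 'E_P[X t] = 0)%E /\
  (forall (N : nat) (t : 'I_N -> I) (c : 'I_N -> R),
    gaussian P (fun w => \sum_(i < N) c i * X (t i) w)).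

Section moments.
Context (R : realType) (d : nat).
Variables (g : euclid R d -> euclid R d -> R) (D : set (euclid R d))
  (phi : euclid R d -> R).

Definition pair_sum (l : nat) (x : l.-tuple (euclid R d)) : R :=
  \sum_(i < l) \sum_(j < l | (i < j)%N) g (tnth x i) (tnth x j).

(* exp_coeff c is the sequence of coefficients of the formal series
   exp (mu * c) in mu. *)
Definition moment_integrand (l m : nat) (x : l.-tuple (euclid R d)) : R :=
  (\prod_(i < l) phi (tnth x i)) * exp_coeff (pair_sum x) m.

(* The coefficients of the formal power series S_l[phi](mu). *)
Definition moment_series (l : nat) : nat -> R := fun m =>
  \int[power_measure (lebesgue R d) l]_(x in set_power l D)
    moment_integrand m x.

(* All the integrals defining the series S_l[phi], l >= 1, exist; the case
   l = 1, m = 0 is the integrability of phi on D. *)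
Definition moment_series_exist :=
  forall l m : nat, (0 < l)%N ->
    (power_measure (lebesgue R d) l).-integrable (set_power l D)
      (EFin \o @moment_integrand l m).

Definition mean : R := \int[lebesgue R d]_(x in D) phi x.

End moments.

(* The n-th derivative at 0 of a formal power series; pseries_diffs is the
   formal derivative. *)
Definition formal_derive0 (R : realType) (n : nat) (a : nat -> R) : R :=
  iter n (@pseries_diffs R) a 0%N.

Definition H (R : realType) (d : nat) (g : euclid R d -> euclid R d -> R)
    (D : set (euclid R d)) (phi : euclid R d -> R) (n k : nat) : R :=
  (-1) ^+ k / k`!%:R *
  \sum_(2 <= l < k.+1) (-1) ^+ l * 'C(k, l)%:R * mean D phi ^+ (k - l) *
    formal_derive0 n (moment_series g D phi l).

(* Main.v *)
(* Since [pair_sum] vanishes on tuples of length at most 1, the sum defining H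
   may start at l = 0, and the term of index l is a sum over the subsets A of
   {0, ..., k-1} with l elements.  By Fubini, mean^(k-l) times the moment of
   order l is the integral over D^k of prod_i phi(x_i) times a function of the
   coordinates indexed by A.  Hence H is, up to a constant factor, the integral
   over D^k of prod_i phi(x_i) times
     sum_A (-1)^|A| (sum_(i<j in A) g(x_i,x_j))^n.
   That alternating sum is identically 0: a monomial of the n-th power involves
   at most 2n < k indices, and toggling a missing one in A changes the sign. *)

Require Import Defs.
From mathcomp Require Import all_boot all_order all_algebra.
From mathcomp Require Import all_classical all_reals all_analysis.
From mathcomp Require Import measurable_realfun.
Import Order.TTheory GRing.Theory Num.Theory.
Import numFieldNormedType.Exports.
Local Open Scope classical_set_scope.
Local Open Scope ring_scope.

Set Implicit Arguments.
Unset Strict Implicit.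
Unset Printing Implicit Defensive.

(** * Alternating sums over the subsets of a finite type *)

(** The subsets that contain [v] are matched with those that do not by removing [v]; matched terms
    have the same [B] and opposite signs. *)
Lemma alternating_sum_toggle (R : numDomainType) (T : finType) (v : T)
    (B : {set T} -> R) :
  (forall A, B (v |: A)%SET = B (A :\ v)%SET) ->
  \sum_(A : {set T}) (-1) ^+ #|A| * B A = 0.
Proof.
move=> Bv; rewrite (bigID (fun A : {set T} => v \in A)) /=.
rewrite (reindex_onto (fun A => v |: A)%SET (fun A => A :\ v)%SET) /=;
  last first.
  by move=> A vA; rewrite finset.setD1K.
rewrite -[X in _ + X]opprK; apply/eqP; rewrite subr_eq0; apply/eqP.
rewrite -sumrN; apply: eq_big => [A|A].
  rewrite finset.setU11 /=; apply/eqP/idP => [<-|vA].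
    by rewrite !inE eqxx.
  by rewrite finset.setU1K.
rewrite finset.setU11 /= => /eqP vA.
have vA' : v \notin A by rewrite -vA !inE eqxx.
have Av : (A :\ v)%SET = A.
  by apply/setP => x; rewrite !inE; case: eqVneq => // ->; rewrite (negbTE vA').
by rewrite cardsU1 vA' exprS mulN1r mulNr Bv Av.
Qed.

Lemma alternating_sum_pair_power (R : numDomainType) (T : finType) (n : nat)
    (a : T * T -> R) :
  (2 * n < #|T|)%N ->
  \sum_(A : {set T}) (-1) ^+ #|A| *
    (\sum_(p | (p.1 \in A) && (p.2 \in A)) a p) ^+ n = 0.
Proof.
move=> nT.
(* Extending [a] by 0 outside the pairs in [A] makes the index set of the expanded power independent
   of [A], so the two sums can be exchanged. *)
have E (A : {set T}) : (\sum_(p | (p.1 \in A) && (p.2 \in A)) a p) ^+ n =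
    \sum_(f : {ffun 'I_n -> T * T})
      \prod_(i < n) (if ((f i).1 \in A) && ((f i).2 \in A) then a (f i) else 0).
  rewrite -(bigA_distr_bigA
    (fun (i : 'I_n) p => if (p.1 \in A) && (p.2 \in A) then a p else 0)) /=.
  by rewrite prodr_const card_ord -big_mkcond.
under eq_bigr do rewrite E big_distrr /=.
rewrite exchange_big /=; apply: big1 => f _.
(* The indices occurring in the monomial [f]: at most [2 * n] of them, so some [v] is missing and
   can be toggled. *)
pose U := ([set (f i).1 | i : 'I_n] :|: [set (f i).2 | i : 'I_n])%SET.
have [v vU] : exists v, v \notin U.
  apply/existsP; rewrite -negb_forall; apply: contraTN nT => /forallP TU.
  rewrite -leqNgt -cardsT (_ : [set: T]%SET = U); last first.
    by apply/setP => x; rewrite TU inE.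
  rewrite (leq_trans (leq_card_setU _ _))// mul2n -addnn.
  by apply: leq_add; rewrite (leq_trans (leq_imset_card _ _))// card_ord.
apply: (@alternating_sum_toggle _ _ v) => A.
apply: eq_bigr => i _.
have h1 : ((f i).1 == v) = false.
  apply: contraNF vU => /eqP <-; rewrite finset.in_setU.
  by apply/orP; left; apply/imsetP; exists i.
have h2 : ((f i).2 == v) = false.
  apply: contraNF vU => /eqP <-; rewrite finset.in_setU.
  by apply/orP; right; apply/imsetP; exists i.
by rewrite !inE h1 h2.
Qed.

Lemma formal_derive0E (R : realType) (n : nat) (a : nat -> R) :
  formal_derive0 n a = n`!%:R * a n.
Proof.
rewrite /formal_derive0.
(* Each formal derivative shifts the index, so the induction needs every coefficient [i]; the factor
   [i!] avoids the quotient [(i + n)! / i!]. *)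
suff H i : iter n (@pseries_diffs R) a i * i`!%:R = (i + n)`!%:R * a (i + n)%N.
  by have := H 0%N; rewrite fact0 mulr1 add0n.
elim: n i => [|n IH] i; first by rewrite addn0 mulrC.
rewrite iterS /pseries_diffs -/(pseries_diffs _) mulrAC -natrM -factS mulrC.
by rewrite IH addSnnS.
Qed.

(** * Integrals over power measures of functions of a subtuple selected by a mask *)

Lemma ge0_integral_power_measureS d (T : measurableType d) (R : realType)
    (m : {sigma_finite_measure set T -> \bar R}) (n : nat)
    (f : n.+1.-tuple T -> \bar R) :
  measurable_fun [set: n.+1.-tuple T] f -> (forall t, 0 <= f t)%E ->
  (\int[power_measure m n.+1]_t f t =
   \int[m]_x \int[power_measure m n]_t f [tuple of x :: t])%E.
Proof.
move=> mf f0; rewrite ge0_integral_pushforward//;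
  last exact: measurable_tuple_cons.
rewrite preimage_setT fubini_tonelli1//.
  by apply: measurableT_comp => //; exact: measurable_tuple_cons.
by move=> [x t]; exact: f0.
Qed.

(** The length of [mask b t] depends only on [b] and [k], so masking is a selection of fixed
    coordinates, those listed in [s]. The case [k = 0] is apart because [inord] needs a nonempty
    ordinal type. *)
Lemma measurable_fun_mask d d' (T : measurableType d) (U : measurableType d')
    (F : seq T -> U) (b : bitseq) (k : nat) :
  (forall l, measurable_fun [set: l.-tuple T] (fun t : l.-tuple T => F t)) ->
  measurable_fun [set: k.-tuple T] (fun t : k.-tuple T => F (mask b t)).
Proof.
case: k => [|k] mF.
  rewrite (_ : (fun _ => _) = cst (F [::])); first exact: measurable_cst.
  by apply/funext => t; rewrite tuple0 mask0.
pose s := mask b (iota 0 k.+1).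
rewrite (_ : (fun _ => _) =
  (fun u : (size s).-tuple T => F u) \o
  (fun t : k.+1.-tuple T =>
     [tuple of [seq tnth t (inord j) | j <- in_tuple s]])).
  apply: measurableT_comp; first exact: mF.
  apply/measurable_fun_tnthP => i.
  rewrite (_ : _ \o _ = (fun t : k.+1.-tuple T =>
    tnth t (inord (tnth (in_tuple s) i)))); first exact: measurable_tnth.
  by apply/funext => t /=; rewrite tnth_map.
apply/funext => t /=; rewrite map_mask; congr (F (mask b _)).
apply: (@eq_from_nth _ (thead t)) => [|i].
  by rewrite size_map size_iota size_tuple.
rewrite size_tuple => ik; rewrite (nth_map 0%N) ?size_iota// nth_iota//.
by rewrite (tnth_nth (thead t)) inordK.
Qed.

Lemma measurable_fun_prod_tuple d (T : measurableType d) (R : realType)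
    (w : T -> R) (l : nat) : measurable_fun setT w ->
  measurable_fun [set: l.-tuple T] (fun t : l.-tuple T => \prod_(x <- t) w x).
Proof.
move=> mw.
under eq_fun do rewrite big_tuple.
apply: measurable_prod => i _; apply: measurableT_comp => //.
exact: measurable_tnth.
Qed.

(* Integrands are functions of sequences, so that they apply to the subtuple
   selected by a mask, whatever its length. *)
Section integral_mask.
Context d (T : measurableType d) (R : realType).
Variables (mu : {sigma_finite_measure set T -> \bar R}) (w : T -> R) (c : R).
Hypotheses (mw : measurable_fun setT w) (w_ge0 : forall x, 0 <= w x)
  (wc : (\int[mu]_x (w x)%:E = c%:E)%E).

Let compl_weight (b : bitseq) (t : seq T) : R :=
  \prod_(x <- mask (map negb b) t) w x.

Let compl_weight_ge0 b t : 0 <= compl_weight b t.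
Proof. exact: prodr_ge0. Qed.

Let measurable_compl_weight b l :
  measurable_fun [set: l.-tuple T] (fun t : l.-tuple T => compl_weight b t).
Proof.
apply: (@measurable_fun_mask _ _ _ _ (fun s => \prod_(x <- s) w x)) => k.
exact: measurable_fun_prod_tuple.
Qed.

Let measurable_compl_weight_mask (b : bitseq) (k : nat) (F : seq T -> \bar R) :
  (forall l, measurable_fun [set: l.-tuple T] (fun t : l.-tuple T => F t)) ->
  measurable_fun [set: k.-tuple T]
    (fun t : k.-tuple T => (compl_weight b t)%:E * F (mask b t))%E.
Proof.
move=> mF; apply: emeasurable_funM.
  by apply/measurable_EFinP; exact: measurable_compl_weight.
exact: measurable_fun_mask.
Qed.

(** Induction on the mask, integrating out the first coordinate by Tonelli: a kept coordinate is
    absorbed as first entry of the argument of [F], a dropped one contributes a factor [c]. *)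
Lemma ge0_integral_mask (b : bitseq) (F : seq T -> \bar R) :
  (forall l, measurable_fun [set: l.-tuple T] (fun t : l.-tuple T => F t)) ->
  (forall s, 0 <= F s)%E ->
  (\int[power_measure mu (size b)]_t
     ((compl_weight b t)%:E * F (mask b t)) =
   (c ^+ count negb b)%:E * \int[power_measure mu (count id b)]_t F t)%E.
Proof.
have c_ge0 : 0 <= c.
  by rewrite -lee_fin -wc; apply: integral_ge0 => x _; rewrite lee_fin.
elim: b F => [|b bs IH] F mF F0.
  rewrite /= expr0 mul1e; apply: eq_integral => t _.
  by rewrite /compl_weight /= big_nil mul1e tuple0.
have -> := ge0_integral_power_measureS mu
  (@measurable_compl_weight_mask (b :: bs) (size bs).+1 F mF); last first.
  by move=> t; rewrite mule_ge0 ?lee_fin ?compl_weight_ge0 ?F0.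
have mFx x l :
    measurable_fun [set: l.-tuple T] (fun t : l.-tuple T => F (x :: t)).
  apply: (measurableT_comp (mF l.+1)
    (g := fun t : l.-tuple T => [tuple of x :: t])).
  by apply: measurable_cons => //; exact: measurable_cst.
case: b.
- have -> := ge0_integral_power_measureS mu
    (mF (count id bs).+1) (fun t => F0 t).
  rewrite -[count negb (true :: bs)]/(count negb bs).
  rewrite -ge0_integralZl//; last 3 first.
  + apply: (measurable_fun_fubini_tonelli_F
      (fun xt : T * (count id bs).-tuple T => F (xt.1 :: xt.2))) => //.
    exact: (measurableT_comp (mF (count id bs).+1)
      (@measurable_tuple_cons _ T (count id bs))).
  + by move=> x _; exact: integral_ge0.
  + by rewrite lee_fin exprn_ge0.
  by apply: eq_integral => x _; rewrite -(IH (fun s => F (x :: s))).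
- rewrite -[count negb (false :: bs)]/(count negb bs).+1.
  rewrite -[count id (false :: bs)]/(count id bs) exprS EFinM.
  rewrite -muleA -wc -ge0_integralZr//; last 3 first.
  + exact/measurable_EFinP.
  + by move=> x _; rewrite lee_fin.
  + by rewrite mule_ge0// ?lee_fin ?exprn_ge0//; exact: integral_ge0.
  apply: eq_integral => x _; rewrite -IH// -ge0_integralZl//.
  + by apply: eq_integral => t _; rewrite /compl_weight /= big_cons EFinM muleA.
  + exact: measurable_compl_weight_mask.
  + by move=> t _; rewrite mule_ge0 ?lee_fin ?compl_weight_ge0 ?F0.
  + by rewrite lee_fin.
Qed.

(** The nonnegative case applied to the absolute value of [F] bounds the integral. *)
Lemma integrable_mask (b : bitseq) (k l : nat) (F : seq T -> R) :
  size b = k -> count id b = l ->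
  (forall j, measurable_fun [set: j.-tuple T] (fun t : j.-tuple T => F t)) ->
  (power_measure mu l).-integrable [set: l.-tuple T]
    (fun t : l.-tuple T => (F t)%:E) ->
  (power_measure mu k).-integrable [set: k.-tuple T]
    (fun t : k.-tuple T => (compl_weight b t * F (mask b t))%:E).
Proof.
move=> <- <- mF /integrableP[_ intF]; apply/integrableP; split.
  under eq_fun do rewrite EFinM.
  apply: (@measurable_compl_weight_mask b (size b) (EFin \o F)) => j.
  by apply/measurable_EFinP; exact: mF.
under eq_integral do
  rewrite EFinM abseM (gee0_abs (x := (compl_weight _ _)%:E)) ?lee_fin//.
rewrite (@ge0_integral_mask b (fun s => `|(F s)%:E|%E))//; last first.
  by move=> j; apply: measurableT_comp => //; apply/measurable_EFinP; exact: mF.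
rewrite lte_mul_pinfty ?lee_fin ?exprn_ge0//.
by rewrite -lee_fin -wc; apply: integral_ge0 => x _; rewrite lee_fin.
Qed.

(** The nonnegative case applies to the positive and negative parts of [F]; the weight, being
    nonnegative, commutes with taking these parts. *)
Lemma integral_mask (b : bitseq) (k l : nat) (F : seq T -> R) :
  size b = k -> count id b = l ->
  (forall j, measurable_fun [set: j.-tuple T] (fun t : j.-tuple T => F t)) ->
  (power_measure mu l).-integrable [set: l.-tuple T]
    (fun t : l.-tuple T => (F t)%:E) ->
  (\int[power_measure mu k]_t (compl_weight b t * F (mask b t))%:E =
   (c ^+ count negb b)%:E * \int[power_measure mu l]_t (F t)%:E)%E.
Proof.
move=> <- <- mF intF; rewrite integralE [in RHS]integralE.
have mG j : measurable_fun [set: j.-tuple T] (fun t : j.-tuple T => (F t)%:E).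
  by apply/measurable_EFinP; exact: mF.
rewrite muleBr//; last first.
  exact: (integrable_add_def measurableT intF).
have P := @ge0_integral_mask b (EFin \o F)^\+%E.
have {}P := P _ (fun s => funepos_ge0 _ s).
have N := @ge0_integral_mask b (EFin \o F)^\-%E.
have {}N := N _ (fun s => funeneg_ge0 _ s).
transitivity (
  \int[power_measure mu (size b)]_t
     ((compl_weight b t)%:E * (EFin \o F)^\+ (mask b t)) -
  \int[power_measure mu (size b)]_t
     ((compl_weight b t)%:E * (EFin \o F)^\- (mask b t)))%E;
  last first.
  rewrite P => [|j]; last first.
    rewrite -[X in measurable_fun _ X]/((EFin \o F)^\+%E \o @tval j T).
    rewrite -funepos_comp.
    exact: measurable_funepos (mG j).
  rewrite N => [|j]; last first.
    rewrite -[X in measurable_fun _ X]/((EFin \o F)^\-%E \o @tval j T).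
    rewrite -funeneg_comp.
    exact: measurable_funeneg (mG j).
  by congr (_ * _ - _ * _)%E; apply: eq_integral => t _;
    rewrite ?funeposE ?funenegE.
congr (_ - _)%E; apply: eq_integral => t _.
- by rewrite !funeposE /= EFinM maxe_pMr ?mule0// lee_fin.
- by rewrite !funenegE maxe_pMr ?lee_fin// mule0 muleN -EFinM.
Qed.
End integral_mask.

(* Rational boxes form a countable base, so the product sigma-algebra contains
   the closed sets. *)
Lemma measurable_euclid_compact (R : realType) (d : nat)
    (D : set (euclid R d)) :
  euclid_compact D -> measurable D.
Proof.
pose row (x : euclid R d) := \row_(i < d) tnth x i : 'rV[R]_d.
have row_inj : injective row.
  move=> x y /rowP xy; apply: eq_from_tnth => i.
  by have := xy i; rewrite !mxE.
move=> /(compact_closed (@norm_hausdorff R 'rV[R]_d)) /closed_openC.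
set U := ~` _ => oU.
(* The cube with rational centre [q.1] and half-side [1 / (q.2 + 1)]; there are countably many. *)
pose box (q : 'rV[rat]_d * nat) : set (euclid R d) :=
  \bigcap_(i : 'I_d) ((fun x => tnth x i) @^-1`
     (ball (ratr (q.1 ord0 i) : R) q.2.+1%:R^-1)).
have mbox q : measurable (box q).
  apply: fin_bigcap_measurable => [|i _]; first exact: finite_finset.
  rewrite -[X in measurable X]setTI; apply: measurable_tnth => //.
  exact: measurable_realfun.measurable_ball.
pose good (q : 'rV[rat]_d * nat) := box q `<=` row @^-1` U.
suff -> : D = ~` (\bigcup_(q in [set q | good q]) box q).
  apply: measurableC; rewrite bigcup_mkcond.
  apply: countable_bigcupT_measurable; first exact: countableP.
  by move=> q; case: ifP.
rewrite -[LHS]setCK; congr (~` _); apply/seteqP; split => [x Dx|x [q gq /gq]].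
  have Ux : U (row x) by move=> [y Dy /row_inj yx]; apply: Dx; rewrite -yx.
  have /nbhs_ballP[e /= e0 eU] : nbhs (row x) U by apply: open_nbhs_nbhs.
  (* Two points of the box are each within [e / 2] of its centre in every coordinate, so the box
     around [x] stays in the [e]-ball. *)
  have [m me] : exists m : nat, (0 : R) + m.+1%:R^-1 < e / 2.
    by apply: ltr_add_invr; rewrite divr_gt0.
  rewrite add0r in me.
  have m0 : (0 : R) < m.+1%:R^-1 by rewrite invr_gt0.
  have /choice[q qP] (i : 'I_d) : exists q : rat,
      ball (ratr q : R) m.+1%:R^-1 (tnth x i).
    have [|q] := @rat_in_itvoo R (tnth x i) (tnth x i + m.+1%:R^-1).
      by rewrite ltrDl.
    rewrite in_itv /= => /andP[q1 q2]; exists q.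
    by rewrite /ball /= ger0_norm ?subr_ge0 ?(ltW q1)// ltrBlDl.
  exists (\row_i q i, m) => [y /= yb|i _ /=]; last by rewrite mxE; exact: qP.
  apply: eU; split => // i j; rewrite !mxE.
  rewrite (splitr e); apply: ball_triangle.
    exact/ball_sym/(le_ball (ltW me))/(qP j).
  by apply/(le_ball (ltW me)); have := yb j I; rewrite /= mxE.
by move=> Ux Dx; apply: Ux; exists x.
Qed.

(** * Sums over sets of indices and over pairs of entries of a sequence *)

Lemma sum_card_set (R : nzRingType) (k : nat) (G : nat -> R) :
  \sum_(A : {set 'I_k}) G #|A| = \sum_(l < k.+1) 'C(k, l)%:R * G l.
Proof.
rewrite (partition_big (fun A : {set 'I_k} => inord #|A| : 'I_k.+1) xpredT)//=.
apply: eq_bigr => l _; under eq_bigl => A.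
  rewrite -val_eqE /= inordK; last by rewrite ltnS -[leqRHS]card_ord max_card.
  over.
rewrite (eq_bigr (fun=> G l)); last by move=> A /eqP ->.
have := card_draws 'I_k l.
by rewrite card_ord sumr_const cardsE mulr_natl => <-.
Qed.

Section seq_pair_sum.
Context (T : Type) (R : nmodType) (g : T -> T -> R).

(** The counterpart of [pair_sum] on sequences of any length, so that it can be evaluated on a
    masked tuple. *)
Fixpoint seq_pair_sum (s : seq T) : R :=
  if s is x :: s' then \sum_(y <- s') g x y + seq_pair_sum s' else 0.

(** In a strictly increasing list of indices, [i] stands before [j] exactly when [i < j]. *)
Lemma seq_pair_sum_map (k : nat) (f : 'I_k -> T) (s : seq 'I_k) :
  sorted (fun i j : 'I_k => (i < j)%N) s ->
  seq_pair_sum [seq f i | i <- s] =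
  \sum_(i <- s) \sum_(j <- s | (i < j)%N) g (f i) (f j).
Proof.
elim: s => [|x s IH] /=; first by rewrite big_nil.
move=> /[dup] /path_sorted sorted_s.
rewrite path_sortedE => [/andP[/allP xs _]|]; last first.
  by move=> ? ? ?; exact: ltn_trans.
rewrite IH// big_map !big_cons ltnn [in LHS]big_seq [in RHS]big_seq_cond.
congr (_ + _).
  by apply: eq_bigl => y; case: (boolP (y \in s)) => //= /xs ->.
rewrite !big_seq; apply: eq_bigr => y ys.
by rewrite big_cons ltnNge (ltnW (xs _ ys)).
Qed.

Lemma sorted_enum_ord (k : nat) (A : {set 'I_k}) :
  sorted (fun i j : 'I_k => (i < j)%N) (enum A).
Proof.
rewrite {1}/enum_mem sorted_filter//; first by move=> ? ? ?; exact: ltn_trans.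
rewrite -enumT -(sorted_map (f := val) (e' := ltn)).
by rewrite val_enum_ord iota_ltn_sorted.
Qed.

Lemma mask_mem_enum (k : nat) (A : {set 'I_k}) (t : k.-tuple T) :
  mask [seq i \in A | i <- enum 'I_k] t = [seq tnth t i | i <- enum A].
Proof.
rewrite -[X in mask _ X](map_tnth_enum t) -map_mask -filter_mask.
by rewrite [in RHS]/enum_mem -enumT; congr map; exact: eq_filter.
Qed.

Lemma seq_pair_sum_mask (k : nat) (A : {set 'I_k}) (t : k.-tuple T) :
  seq_pair_sum (mask [seq i \in A | i <- enum 'I_k] t) =
  \sum_(p : 'I_k * 'I_k | (p.1 \in A) && (p.2 \in A))
    (if (p.1 < p.2)%N then g (tnth t p.1) (tnth t p.2) else 0).
Proof.
rewrite mask_mem_enum seq_pair_sum_map ?sorted_enum_ord//.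
rewrite big_enum -(pair_big (mem A) (mem A)
  (fun i j => if (i < j)%N then g (tnth t i) (tnth t j) else 0)) /=.
by apply: eq_bigr => i _; rewrite big_mkcond big_enum.
Qed.

Lemma seq_pair_sum_tuple (k : nat) (t : k.-tuple T) :
  seq_pair_sum t =
  \sum_(i < k) \sum_(j < k | (i < j)%N) g (tnth t i) (tnth t j).
Proof.
rewrite -[in LHS](map_tnth_enum t) seq_pair_sum_map.
  by rewrite big_enum; apply: eq_bigr => i _; rewrite big_enum_cond.
by rewrite enumT -enum_setT sorted_enum_ord.
Qed.

End seq_pair_sum.

Lemma prod_mask_negb (R : comPzRingType) (T : Type) (w : T -> R) (b : bitseq)
    (s : seq T) : size b = size s ->
  (\prod_(x <- mask (map negb b) s) w x) * (\prod_(x <- mask b s) w x) =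
  \prod_(x <- s) w x.
Proof.
elim: b s => [|b bs IH] [|x s]//=; first by rewrite !big_nil mul1r.
move=> [/IH IHs]; rewrite [in RHS]big_cons -IHs.
by case: b; rewrite /= big_cons; [rewrite mulrCA | rewrite mulrA].
Qed.

(** * Moments as integrals over the whole space, and the vanishing of their alternating sum *)

Section moments_as_mask_integrals.
Context (R : realType) (d : nat).
Variables (g : euclid R d -> euclid R d -> R) (D : set (euclid R d))
  (phi : euclid R d -> R).
Hypotheses (mD : measurable D) (phi_gt0 : forall x, D x -> 0 < phi x)
  (S_exist : moment_series_exist g D phi).

(** Extension by 0 outside [D] turns integrals over powers of [D] into integrals over the full power
    space, where masks apply. *)
Let w : euclid R d -> R := phi \_ D.
Let F (n : nat) (s : seq (euclid R d)) : R :=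
  (\prod_(x <- s) w x) * exp_coeff (seq_pair_sum g s) n.

Let w_ge0 x : 0 <= w x.
Proof. by rewrite /w patchE; case: ifPn => // /set_mem /phi_gt0 /ltW. Qed.

Let measurable_set_power l : measurable (@set_power (euclid R d) l D).
Proof.
rewrite (_ : set_power l D =
  \bigcap_(i : 'I_l) ((fun t : l.-tuple (euclid R d) => tnth t i) @^-1` D)).
  apply: fin_bigcap_measurable => [|i _]; first exact: finite_finset.
  by rewrite -[X in measurable X]setTI; exact: measurable_tnth.
by apply/seteqP; split => [t Dt i _|t Dt i]; exact: Dt.
Qed.

Let FE n l : (fun t : l.-tuple (euclid R d) => F n t) =
  moment_integrand g phi n \_ (set_power l D).
Proof.
apply/funext => t; rewrite patchE /F seq_pair_sum_tuple big_tuple.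
case: ifPn => [/set_mem Dt|/negP Dt].
  congr (_ * _); apply: eq_bigr => i _.
  by rewrite /w patchE mem_set//; exact: Dt.
have [i Di] : exists i, ~ D (tnth t i).
  by apply/existsNP => Dt'; apply: Dt; rewrite inE.
by rewrite (bigD1 i)//= {1}/w patchE memNset// !mul0r.
Qed.

Let F_integrable n l : (0 < l)%N ->
  (power_measure (lebesgue R d) l).-integrable
    [set: l.-tuple (euclid R d)] (fun t => (F n t)%:E).
Proof.
move=> l0.
have /(integrable_mkcond _ (@measurable_set_power l)) := S_exist n l0.
by rewrite restrict_EFin -FE.
Qed.

Let integrable_w : (lebesgue R d).-integrable setT (fun x => (w x)%:E).
Proof.
(* The integrability of [w] is the case [l = 1], degree 0, of [S_exist]. *)
have F0E x : F 0 [:: x] = w x.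
  by rewrite /F big_seq1 /exp_coeff/= expr0 fact0 divr1 mulr1.
have /integrableP[mF intF] := F_integrable 0 (ltn0Sn 0).
have mw : measurable_fun setT (fun x => (w x)%:E).
  under eq_fun do rewrite -F0E.
  apply: (measurableT_comp mF (g := fun x => [tuple x])).
  by apply: measurable_cons => //; exact: measurable_cst.
apply/integrableP; split => //; move: intF.
rewrite ge0_integral_power_measureS//; last exact: measurableT_comp.
congr (_ < _)%E; apply: eq_integral => x _.
rewrite (eq_integral (cst `|(w x)%:E|%E)) => [|t _].
  by rewrite integral_dirac//= /dirac indicT mul1e.
by rewrite tuple0 /= F0E.
Qed.

Let integral_w : (\int[lebesgue R d]_x (w x)%:E = (mean D phi)%:E)%E.
Proof.
rewrite /mean Rintegral_mkcond /Rintegral fineK//.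
exact: (integrable_fin_num measurableT integrable_w).
Qed.

Section positive_degree.
Variables (n : nat) (n_gt0 : (0 < n)%N).

Let F_integrableT l : (power_measure (lebesgue R d) l).-integrable
    [set: l.-tuple (euclid R d)] (fun t => (F n t)%:E).
Proof.
case: l => [|l]; last exact: F_integrable.
(* [S_exist] starts at [l = 1]; on the empty tuple the pair sum is 0, and so is its [n]-th power
   since [n > 0]. *)
rewrite (_ : (fun _ => _) = cst 0%E); first exact: integrable0.
apply/funext => t; rewrite tuple0 /F big_nil mul1r /exp_coeff /=.
by rewrite expr0n eqn0Ngt n_gt0 mul0r.
Qed.

Let momentE l : ((moment_series g D phi l n)%:E =
  \int[power_measure (lebesgue R d) l]_t (F n t)%:E)%E.
Proof.
rewrite /moment_series Rintegral_mkcond -FE /Rintegral fineK//.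
exact: (integrable_fin_num measurableT (@F_integrableT l)).
Qed.

Lemma alternating_moment_sum k : (2 * n < k)%N ->
  \sum_(A : {set 'I_k}) (-1) ^+ #|A| *
    (mean D phi ^+ (k - #|A|) * moment_series g D phi #|A| n) = 0.
Proof.
(* The indicator of [A] as a mask: the term of [A] becomes an integral of [f A] over [k]-tuples, a
   domain common to all [A]. *)
move=> nk; pose b (A : {set 'I_k}) := [seq i \in A | i <- enum 'I_k].
have szb A : size (b A) = k by rewrite size_map size_enum_ord.
have cb A : count id (b A) = #|A|.
  by rewrite count_map cardE [in RHS]/enum_mem size_filter -enumT;
    exact: eq_count.
have cNb A : count negb (b A) = (k - #|A|)%N.
  by have := count_predC id (b A); rewrite szb cb => /(canRL (addKn _)).
pose f A (t : k.-tuple (euclid R d)) :=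
  \prod_(x <- mask (map negb (b A)) t) w x * F n (mask (b A) t).
have mF j : measurable_fun [set: j.-tuple (euclid R d)]
    (fun t : j.-tuple (euclid R d) => F n t).
  have /integrableP[mFj _] := @F_integrableT j.
  by apply/measurable_EFinP; exact: mFj.
have mw : measurable_fun setT w.
  have /integrableP[mw _] := integrable_w.
  by apply/measurable_EFinP; exact: mw.
have intf A : (power_measure (lebesgue R d) k).-integrable
    [set: k.-tuple (euclid R d)] (fun t => (f A t)%:E).
  exact: (integrable_mask mw w_ge0 integral_w (szb A) (cb A)
    mF (@F_integrableT _)).
apply: EFin_inj; rewrite -sumEFin.
transitivity (\int[power_measure (lebesgue R d) k]_t
    \sum_(A : {set 'I_k}) ((-1) ^+ #|A| * f A t)%:E)%E.
  rewrite integral_sum//; last first.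
    by move=> A; under eq_fun do rewrite EFinM; exact: integrableZl.
  apply: eq_bigr => A _; under [RHS]eq_integral do rewrite EFinM.
  rewrite integralZl//.
  by rewrite (integral_mask mw w_ge0 integral_w (szb A) (cb A)
    mF (@F_integrableT _))
    cNb !EFinM momentE.
apply: integral0_eq => t _; rewrite sumEFin; congr EFin.
(* The weights inside and outside [A] multiply to the full product, so this factor is common to all
   [A]; what remains is the alternating sum of powers of pair sums. *)
apply: etrans (_ : \prod_(x <- t) w x / n`!%:R * 0 = 0); last exact: mulr0.
rewrite -[X in _ = _ * X](alternating_sum_pair_power (T := 'I_k) (n := n)
  (fun p =>
  if (p.1 < p.2)%N then g (tnth t p.1) (tnth t p.2) else 0)) ?card_ord//.
rewrite mulr_sumr; apply: eq_bigr => A _.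
rewrite -seq_pair_sum_mask /f /F [X in _ * X]mulrA.
rewrite prod_mask_negb ?szb ?size_tuple//.
rewrite /exp_coeff /= [RHS]mulrCA; congr (_ * _).
by rewrite [RHS]mulrAC mulrA.
Qed.

End positive_degree.
End moments_as_mask_integrals.

Theorem theorem3 (R : realType) (d : nat)
    (dOmega : measure_display) (Omega : measurableType dOmega)
    (P : probability Omega R) (X : euclid R d -> {RV P >-> R})
    (g : euclid R d -> euclid R d -> R)
    (D : set (euclid R d)) (phi : euclid R d -> R)
    (X_gaussian : centered_gaussian_process X)
    (g_cov : forall x y, (g x y)%:E = covariance P (X x) (X y))
    (D_compact : euclid_compact D)
    (phi_gt0 : forall x, D x -> 0 < phi x)
    (S_exist : moment_series_exist g D phi)
    (n k : nat) (n_ge1 : (1 <= n)%N) (k_ge2 : (2 <= k)%N) :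
  (2 * n < k)%N -> H g D phi n k = 0.
Proof.
move=> nk; have mD := measurable_euclid_compact D_compact.
(* With at most one point there is no pair, so the coefficients of positive degree vanish; this
   accounts for the terms [l = 0] and [l = 1], absent from [H]. *)
have moment0 l : (l <= 1)%N -> moment_series g D phi l n = 0.
  move=> l1; rewrite /moment_series /Rintegral integral0_eq// => t _.
  rewrite /moment_integrand (_ : pair_sum g t = 0).
    by rewrite /exp_coeff /= expr0n eqn0Ngt n_ge1 mul0r mulr0.
  apply: big1 => i _; apply: big1 => j ij; have := ltn_ord j.
  by rewrite ltnNge (leq_trans l1)// (leq_trans _ ij).
have := alternating_moment_sum mD phi_gt0 S_exist n_ge1 nk.
rewrite (sum_card_set k (fun l => (-1) ^+ l *
  (mean D phi ^+ (k - l) * moment_series g D phi l n))).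
rewrite -(big_mkord xpredT (fun l => 'C(k, l)%:R * ((-1) ^+ l *
  (mean D phi ^+ (k - l) * moment_series g D phi l n)))).
rewrite big_ltn// big_ltn; last by rewrite ltnS ltnW.
rewrite !moment0// !mulr0 !add0r => sum0; rewrite /H.
set S := \sum_(2 <= l < k.+1) _.
(* The factor [n!] relates the [n]-th derivative at 0 to the coefficient of degree [n]. *)
suff -> : S = n`!%:R * 0 by rewrite !mulr0.
rewrite -[X in _ = _ * X]sum0 mulr_sumr /S; apply: eq_bigr => l _.
rewrite formal_derive0E [LHS]mulrCA; congr (_ * _).
by rewrite -!mulrA [LHS]mulrCA.
Qed.
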